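(* Let $q$ be a prime power, $K=\mathbb{F}_q((t^{-1}))$, $\mathbb{L}=\{f\in K:|f|<1\}$, and let $\mu$ be the Haar measure on $K$ normalized so that $\mu(\{f\in K:|f|\le1\})=1$. Let $h\in\mathbb{L}$ with $\deg(h)=-1$. For irrational $f\in\mathbb{L}$ (i.e. $f\notin\mathbb{F}_q(t)$) and $\ell\ge 1$, let $\begin{pmatrix}U_\ell\\ V_\ell\end{pmatrix}$ be the first column of the matrix product $$M_h(f)\,M_h(F_h(f))\cdots M_h(F_h^{\ell-1}(f)).$$ Then for $\mu$-almost every $f\in\mathbb{L}$, $$\lim_{\ell\to\infty}\frac1\ell\log_q\left|f-\frac{U_\ell}{V_\ell}\right|=-\frac{2q}{2q-1}.$$
   Context: $K=\mathbb{F}_q((t^{-1}))$ is the field of formal Laurent series $f=a_nt^n+\dots+a_1t+a_0+a_{-1}t^{-1}+\cdots$ with $a_i\in\mathbb{F}_q$. For such $f$ with $a_n\ne 0$, $\deg(f)=n$ and $|f|=q^{n}$; by convention $\deg(0)=-\infty$ and $|0|=0$. The polynomial part of $f=\sum_{i\le n}a_it^i$ is $[f]=\sum_{0\le i\le n}a_it^i\in\mathbb{F}_q[t]$. Let $\mathcal{O}=\{f\in K:|f|\le1\}$. For $h\in\mathbb{L}$ with $\deg(h)=-1$, the algebraic Farey map $F_h$ is defined for nonzero $f\in\mathcal{O}$ by $$F_h(f)=\begin{cases}\dfrac{f}{1-[(1-h)f^{-1}]\,f}, & \deg(f)\le -1,\\[3mm] \dfrac{1-[(1-h)f^{-1}]\,f}{f},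 & \deg(f)=0,\end{cases}$$ with values in $\mathcal{O}$. For nonzero $f\in\mathcal{O}$ the matrix $M_h(f)$ is $$M_h(f)=\begin{cases}\begin{pmatrix}1&0\\ [(1-h)f^{-1}]&1\end{pmatrix}, & \deg(f)<0,\\[3mm] \begin{pmatrix}0&1\\ 1&[(1-h)f^{-1}]\end{pmatrix}, & \deg(f)=0.\end{cases}$$ If $f$ is irrational, all iterates $F_h^j(f)$ are irrational, hence nonzero. The fractions $U_\ell/V_\ell$ are the principal and intermediate convergents of $f$ with respect to $h$. *)

(* Defs.v *)
From HB Require Import structures.
From mathcomp Require Import all_boot all_order all_algebra.
From mathcomp Require Import all_classical all_reals all_analysis.
From mathcomp Require Import zify.

Set Implicit Arguments.
Unset Strict Implicit.
Unset Printing Implicit Defensive.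

Import Order.TTheory GRing.Theory Num.Theory.
Import numFieldNormedType.Exports.

Local Open Scope classical_set_scope.
Local Open Scope ring_scope.

(* [laurent F] is the field F((t^-1)); the coefficient of t^i in f is [f i],
   and vanishes for all large i. *)
Definition bounded_above_supp (F : fieldType) (a : int -> F) : Prop :=
  exists n : int, forall i : int, n < i -> a i = 0.

Record laurent (F : fieldType) := Laurent {
  lcoef :> int -> F ;
  _ : bounded_above_supp lcoef }.

Section LaurentField.
Variable F : fieldType.
Implicit Types (f g : laurent F) (a b : int -> F).

Lemma lcoefP f : bounded_above_supp f. Proof. by case: f. Qed.

Lemma laurent_eqP f g : (forall i, f i = g i) -> f = g.
Proof.
case: f g => [a Ha] [b Hb] /= /funext E; subst b.
by congr Laurent; exact: Prop_irrelevance.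
Qed.

HB.instance Definition _ := gen_eqMixin (laurent F).
HB.instance Definition _ := gen_choiceMixin (laurent F).

Lemma laurent_supp0 : bounded_above_supp (fun _ => 0 : F).
Proof. by exists 0. Qed.

Lemma laurent_suppN f : bounded_above_supp (fun i => - f i).
Proof. by have [n H] := lcoefP f; exists n => i /H ->; rewrite oppr0. Qed.

Lemma laurent_suppD f g : bounded_above_supp (fun i => f i + g i).
Proof.
have [n Hn] := lcoefP f; have [m Hm] := lcoefP g.
exists (Num.max n m) => i; rewrite gt_max => /andP[/Hn -> /Hm ->].
by rewrite addr0.
Qed.

Definition laurent_zero := Laurent laurent_supp0.
Definition laurent_opp f := Laurent (laurent_suppN f).
Definition laurent_add f g := Laurent (laurent_suppD f g).

Lemma laurent_addA : associative laurent_add.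
Proof. by move=> f g k; apply: laurent_eqP => i /=; rewrite addrA. Qed.
Lemma laurent_addC : commutative laurent_add.
Proof. by move=> f g; apply: laurent_eqP => i /=; rewrite addrC. Qed.
Lemma laurent_add0 : left_id laurent_zero laurent_add.
Proof. by move=> f; apply: laurent_eqP => i /=; rewrite add0r. Qed.
Lemma laurent_addN : left_inverse laurent_zero laurent_opp laurent_add.
Proof. by move=> f; apply: laurent_eqP => i /=; rewrite addNr. Qed.

HB.instance Definition _ := GRing.isZmodule.Build (laurent F)
  laurent_addA laurent_addC laurent_add0 laurent_addN.

(* A sum over all of int, with finite support whenever a and b have supports
   bounded above. *)
Definition laurent_conv a b (k : int) : F := \sum_(i \in [set: int]) a i * b (k - i).

Definition laurent_top a (n : int) := forall i : int, n < i -> a i = 0.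
Definition laurent_trunc a (n : int) (N : nat) : {poly F} := \poly_(i < N) a (n - i%:Z).

Lemma laurent_conv_trunc a b n m (j N : nat) :
  laurent_top a n -> laurent_top b m -> (j < N)%N ->
  laurent_conv a b (n + m - j%:Z) = (laurent_trunc a n N * laurent_trunc b m N)`_j.
Proof.
move=> ta tb jN; rewrite coefM /laurent_conv.
pose h (i : nat) : int := n - i%:Z.
pose G i := a i * b (n + m - j%:Z - i).
have hinj : set_inj `I_j.+1 h.
  by move=> x y _ _ /addrI /oppr_inj [].
rewrite -(@fsbig_widen _ _ _ _ (h @` `I_j.+1) setT G) //=; last first.
  move=> i [_ nhi] /=; rewrite /G.
  have [ni|ni] := ltP n i; first by rewrite ta // mul0r.
  have [mi|mi] := ltP m (n + m - j%:Z - i); first by rewrite tb // mulr0.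
  exfalso; apply: nhi; exists `|n - i|%N => /=; first by lia.
  by rewrite /h; lia.
rewrite fsbig_image // -fsbig_ord; apply: eq_bigr => i _.
rewrite /G /h !coef_poly (leq_ltn_trans _ jN) ?leq_ord //.
rewrite (leq_ltn_trans _ jN) ?leq_subr //; congr (_ * b _).
by have := ltn_ord i; lia.
Qed.

Lemma laurent_conv_top a b n m :
  laurent_top a n -> laurent_top b m -> laurent_top (laurent_conv a b) (n + m).
Proof.
move=> ta tb k nmk; apply: fsbig1 => i _.
have [ni|ni] := ltP n i; first by rewrite ta // mul0r.
rewrite tb ?mulr0 // ltrBrDl (le_lt_trans _ nmk) //.
by rewrite lerD2r.
Qed.

Lemma laurent_suppM f g : bounded_above_supp (laurent_conv f g).
Proof.
have [n Hn] := lcoefP f; have [m Hm] := lcoefP g.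
by exists (n + m); exact: laurent_conv_top.
Qed.

Lemma laurent_supp1 : bounded_above_supp (fun i => (i == 0)%:R : F).
Proof. by exists 0 => i; rewrite lt0r => /andP[/negbTE ->]. Qed.

Definition laurent_one := Laurent laurent_supp1.
Definition laurent_mul f g := Laurent (laurent_suppM f g).

Lemma laurent_top_eq a b n : laurent_top a n -> laurent_top b n ->
  (forall j : nat, a (n - j%:Z) = b (n - j%:Z)) -> forall i, a i = b i.
Proof.
move=> ta tb E i; have [ni|ni] := ltP n i; first by rewrite ta ?tb.
have -> : i = n - `|n - i|%N%:Z; last exact: E.
by rewrite gez0_abs ?subr_ge0 // opprB addrC subrK.
Qed.

Lemma laurent_trunc_conv a b n m N : laurent_top a n -> laurent_top b m ->
  forall j, (j < N)%N -> (laurent_trunc (laurent_conv a b) (n + m) N)`_j =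
     (laurent_trunc a n N * laurent_trunc b m N)`_j.
Proof. by move=> ta tb j jN; rewrite coef_poly jN -laurent_conv_trunc. Qed.

Lemma laurent_mulC : commutative laurent_mul.
Proof.
move=> f g; have [n tf] := lcoefP f; have [m tg] := lcoefP g.
apply: laurent_eqP => /=; apply: (@laurent_top_eq _ _ (n + m)).
- exact: laurent_conv_top.
- by rewrite addrC; exact: laurent_conv_top.
move=> j; rewrite (@laurent_conv_trunc _ _ _ _ _ j.+1) // mulrC.
by rewrite -laurent_conv_trunc // [m + n]addrC.
Qed.

Lemma laurent_mulA : associative laurent_mul.
Proof.
move=> f g k; have [n tf] := lcoefP f; have [m tg] := lcoefP g.
have [p tk] := lcoefP k.
have tfg := laurent_conv_top tf tg; have tgk := laurent_conv_top tg tk.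
apply: laurent_eqP => /=; apply: (@laurent_top_eq _ _ (n + m + p)).
- by rewrite -addrA; exact: laurent_conv_top.
- exact: laurent_conv_top.
move=> j; rewrite -{1}[n + m + p]addrA.
rewrite !(@laurent_conv_trunc _ _ _ _ _ j.+1) //.
transitivity ((laurent_trunc f n j.+1 * laurent_trunc g m j.+1 *
               laurent_trunc k p j.+1)`_j).
  rewrite -mulrA !coefM; apply: eq_bigr => i _; congr (_ * _).
  by rewrite laurent_trunc_conv // ltnS leq_subr.
rewrite !coefM; apply: eq_bigr => i _; congr (_ * _).
by rewrite laurent_trunc_conv.
Qed.

Lemma laurent_mul1 : left_id laurent_one laurent_mul.
Proof.
move=> f; have [n tf] := lcoefP f.
have t1 : laurent_top laurent_one 0.
  by move=> i; rewrite lt0r /= => /andP[/negbTE ->].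
apply: laurent_eqP => /=; apply: (@laurent_top_eq _ _ n) => //.
  by rewrite -[n]add0r; exact: laurent_conv_top.
move=> j; rewrite -{1}[n]add0r (@laurent_conv_trunc _ _ _ _ _ j.+1) //.
have -> : laurent_trunc (fun i => (i == 0)%:R) 0 j.+1 = 1.
  apply/polyP => i; rewrite coef_poly coef1 sub0r oppr_eq0.
  by case: i => [|i] //; case: ifP.
by rewrite mul1r coef_poly ltnSn.
Qed.

Lemma laurent_mulDl : left_distributive laurent_mul laurent_add.
Proof.
move=> f g k; have [n1 tf1] := lcoefP f; have [n2 tg2] := lcoefP g.
have [p tk] := lcoefP k; pose n := Num.max n1 n2.
have tf : laurent_top f n by move=> i; rewrite gt_max => /andP[/tf1].
have tg : laurent_top g n by move=> i; rewrite gt_max => /andP[_ /tg2].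
have tfg : laurent_top (laurent_add f g) n.
  by move=> i ni /=; rewrite tf // tg // addr0.
apply: laurent_eqP => /=; apply: (@laurent_top_eq _ _ (n + p)).
- exact: laurent_conv_top.
- by move=> i ni; rewrite /= !(laurent_conv_top _ _ ni) ?addr0.
move=> j /=; rewrite !(@laurent_conv_trunc _ _ _ _ _ j.+1) // -coefD -mulrDl.
have -> // : laurent_trunc (fun i => f i + g i) n j.+1 =
    laurent_trunc f n j.+1 + laurent_trunc g n j.+1.
apply/polyP => i; rewrite coefD !coef_poly.
by case: ifP => //; rewrite addr0.
Qed.

Lemma laurent_one_neq0 : laurent_one != laurent_zero.
Proof.
apply/eqP => /(congr1 (fun f : laurent F => f 0)) /= /eqP.
by rewrite oner_eq0.
Qed.

HB.instance Definition _ := GRing.Zmodule_isComNzRing.Build (laurent F)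
  laurent_mulA laurent_mulC laurent_mul1 laurent_mulDl laurent_one_neq0.

Definition lead_at f (d : int) : Prop :=
  f d != 0 /\ forall i : int, d < i -> f i = 0.

Lemma lead_exists f : f != 0 -> exists d, lead_at f d.
Proof.
move=> f0; have [n tf] := lcoefP f.
have [j0 fj0] : exists j : nat, f (n - j%:Z) != 0.
  apply/not_existsP => H; move/eqP: f0; apply.
  apply: laurent_eqP; apply: (@laurent_top_eq _ _ n) => // j.
  by apply/eqP; apply: contra_notT (H j).
have ex : exists j : nat, f (n - j%:Z) != 0 by exists j0.
case: (ex_minnP ex) => j fj jmin; exists (n - j%:Z); split=> // i ji.
have [ni|ni] := ltP n i; first exact: tf.
apply/eqP; apply: contraTT ji => fi.
have Ei : i = n - `|n - i|%N%:Z.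
  by rewrite gez0_abs ?subr_ge0 // opprB addrC subrK.
rewrite -leNgt Ei lerD2l lerN2 lez_nat jmin //.
by rewrite -Ei.
Qed.

Fixpoint laurent_inv_seq (u : nat -> F) (n : nat) : seq F :=
  if n is n'.+1 then
    let s := laurent_inv_seq u n' in
    rcons s ((u 0%N)^-1 *
             ((n' == 0%N)%:R - \sum_(m < n') s`_m * u (n' - m)%N))
  else [::].

Lemma laurent_size_inv_seq (a : nat -> F) n : size (laurent_inv_seq a n) = n.
Proof. by elim: n => //= n IH; rewrite size_rcons IH. Qed.

Lemma laurent_inv_series_exists (a : nat -> F) : a 0%N != 0 ->
  exists b : nat -> F,
    forall n, \sum_(m < n.+1) b m * a (n - m)%N = (n == 0%N)%:R.
Proof.
move=> a0; pose b n := (laurent_inv_seq a n.+1)`_n.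
have bE n m : (m < n)%N -> (laurent_inv_seq a n)`_m = b m.
  elim: n => // n IH; rewrite ltnS leq_eqVlt => /orP[/eqP -> //|mn].
  by rewrite /= nth_rcons laurent_size_inv_seq mn IH.
exists b => n; rewrite big_ord_recr /= subnn {2}/b /=.
rewrite nth_rcons laurent_size_inv_seq ltnn eqxx mulrAC mulVf // mul1r.
rewrite [X in _ - X](_ : _ = \sum_(m < n) b m * a (n - m)%N).
  by rewrite addrC subrK.
by apply: eq_bigr => i _; rewrite bE.
Qed.

Lemma laurent_inv_exists f : f != 0 -> exists g, g * f = 1.
Proof.
move=> /lead_exists[d [fd tf]].
have [|b bE] := @laurent_inv_series_exists (fun j => f (d - j%:Z)).
  by rewrite subr0.
pose c (i : int) := if i <= - d then b `|- d - i|%N else 0.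
have tc : laurent_top c (- d) by move=> i; rewrite /c leNgt => ->.
have sc : bounded_above_supp c by exists (- d).
exists (Laurent sc); apply: laurent_eqP => /=; apply: (@laurent_top_eq _ _ (- d + d)).
- exact: laurent_conv_top.
- by rewrite addNr => i; rewrite lt0r => /andP[/negbTE ->].
move=> j; rewrite (@laurent_conv_trunc _ _ _ _ _ j.+1) // coefM addNr sub0r.
rewrite oppr_eq0 eqz_nat -bE; apply: eq_bigr => i _.
rewrite !coef_poly ltn_ord ltnS leq_subr; congr (_ * _).
by rewrite /c gerBl lez_nat /= opprB addrC subrK absz_nat.
Qed.

(* The inverse is picked among the g with g * f = 1, and is 0 when there is
   none. *)
Definition laurent_inv f : laurent F :=
  if pselect (exists g, g * f = 1) is left H then projT1 (cid H) else 0.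

Lemma laurent_mulV f : f != 0 -> laurent_inv f * f = 1.
Proof.
move=> /laurent_inv_exists ex; rewrite /laurent_inv.
by case: pselect => // H; exact: (projT2 (cid H)).
Qed.

Lemma laurent_inv0 : laurent_inv 0 = 0.
Proof.
rewrite /laurent_inv; case: pselect => // H; exfalso.
by have [g /esym/eqP] := H; rewrite mulr0 oner_eq0.
Qed.

HB.instance Definition _ := GRing.ComNzRing_isField.Build (laurent F) laurent_mulV laurent_inv0.

Definition deg f : \bar int :=
  if pselect (exists d, lead_at f d) is left H
  then (projT1 (cid H))%:E else -oo%E.

Lemma deg0 : deg 0 = -oo%E.
Proof.
rewrite /deg; case: pselect => // H; exfalso.
by have [d []] := H; rewrite eqxx.
Qed.

Lemma deg_lead f d : lead_at f d -> deg f = d%:E.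
Proof.
move=> [fd td]; rewrite /deg; case: pselect => [H|[]]; last by exists d.
case: (cid H) => e /= [fe te]; congr EFin; apply/eqP.
rewrite eq_le !leNgt; apply/andP; split; apply/negP.
  by move=> /td E; rewrite E eqxx in fe.
by move=> /te E; rewrite E eqxx in fd.
Qed.

Lemma laurent_supp_poly (p : {poly F}) :
  bounded_above_supp (fun i : int => if 0 <= i then p`_`|i|%N else 0).
Proof.
exists (size p)%:Z => i si; case: ifP => // i0.
by rewrite nth_default // -lez_nat gez0_abs // ltW.
Qed.

(* The inclusion F[t] -> F((t^-1)). *)
Definition laurent_of_poly (p : {poly F}) : laurent F := Laurent (laurent_supp_poly p).

(* If d < 0 then f i = 0 for all i >= 0, so the truncation at `|d| is 0. *)
Definition poly_part f : {poly F} :=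
  if deg f is EFin d then \poly_(i < `|d|.+1) f i%:Z else 0.

Definition laurent_rational f : Prop :=
  exists p r : {poly F}, r != 0 /\ f = laurent_of_poly p / laurent_of_poly r.

(* The metric topology: |g - f| < q^n iff deg (g - f) < n. *)
Definition laurent_open (A : set (laurent F)) : Prop :=
  forall f, A f -> exists n : int,
    forall g, (deg (g - f)%R < n%:E)%E -> A g.

Lemma laurent_openT : laurent_open setT. Proof. by move=> f _; exists 0. Qed.

Lemma laurent_openI : setI_closed laurent_open.
Proof.
move=> A B oA oB f [/oA [n An] /oB [m Bm]]; exists (Num.min n m) => g gf.
by split; [apply: An | apply: Bm]; apply: (lt_le_trans gf);
  rewrite lee_fin ge_min lexx ?orbT.
Qed.

Lemma laurent_open_bigU (I : Type) (A : I -> set (laurent F)) :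
  (forall i, laurent_open (A i)) -> laurent_open (\bigcup_i A i).
Proof.
by move=> oA f [i _ /oA[n An]]; exists n => g /An Ag; exists i.
Qed.

HB.instance Definition _ := isPointed.Build (laurent F) 0.
HB.instance Definition _ := isOpenTopological.Build (laurent F)
  laurent_openT laurent_openI laurent_open_bigU.

End LaurentField.

(* The Borel sigma-algebra. *)
HB.instance Definition _ (F : fieldType) := Measurable.copy (laurent F)
  (g_sigma_algebraType (@open (laurent F))).

Definition absv (R : realType) (F : finFieldType) (f : laurent F) : R :=
  if deg f is EFin d then #|F|%:R ^ d else 0.

Definition logb (R : realType) (b x : R) : R := ln x / ln b.

Definition unit_ball (R : realType) (F : finFieldType) : set (laurent F) :=
  [set f | absv R f <= 1].

Definition open_unit_ball (R : realType) (F : finFieldType) :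
  set (laurent F) := [set f | absv R f < 1].

Arguments unit_ball : clear implicits.
Arguments open_unit_ball : clear implicits.

(* Invariance and the normalization characterize the Haar measure: they imply
   finiteness on compact sets, and regularity is automatic because laurent F is locally
   compact and second countable. *)
Definition normalized_haar (R : realType) (F : finFieldType)
    (mu : {measure set (laurent F) -> \bar R}) : Prop :=
  (forall (f : laurent F) (A : set (laurent F)), measurable A ->
     mu [set f + g | g in A] = mu A) /\
  mu (unit_ball R F) = 1%E.

Section Farey.
Variable F : fieldType.
Implicit Types h f : laurent F.

Definition farey_part h f : laurent F :=
  laurent_of_poly (poly_part ((1 - h) * f^-1)).

(* [farey] and [farey_mx] are only meaningful for f != 0 with deg f <= 0. *)
Definition farey h f : laurent F :=
  if (deg f <= (-1)%:E)%E then f / (1 - farey_part h f * f)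
  else (1 - farey_part h f * f) / f.

Definition farey_mx h f : 'M[laurent F]_2 :=
  \matrix_(i < 2, j < 2)
    if (deg f < 0%:E)%E then
      (if i == 0 then (if j == 0 then 1 else 0)
       else (if j == 0 then farey_part h f else 1))
    else
      (if i == 0 then (if j == 0 then 0 else 1)
       else (if j == 0 then 1 else farey_part h f)).

Definition farey_prod h f (l : nat) : 'M[laurent F]_2 :=
  \prod_(j < l) farey_mx h (iter j (farey h) f).

Definition farey_num h f l : laurent F := farey_prod h f l 0 0.
Definition farey_den h f l : laurent F := farey_prod h f l 1 0.

End Farey.

(* Main.v *)
Require Import Defs.
From mathcomp Require Import all_boot all_order all_algebra.
From mathcomp Require Import all_classical all_reals all_analysis.
From mathcomp Require Import zify ring lra.

Set Implicit Arguments.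
Unset Strict Implicit.
Unset Printing Implicit Defensive.

Import Order.TTheory GRing.Theory Num.Theory.
Import numFieldNormedType.Exports.
Local Open Scope classical_set_scope.
Local Open Scope ring_scope.

(* Let T f be the fractional part of 1/f, let A_1, A_2, ... be the partial
   quotients of f, and d_k = deg A_1 + ... + deg A_k the degree of the k-th
   continuant.  As deg h = -1, a Farey step raises deg f from -n to -n + 1
   while keeping the fractional part of 1/f, and a step at degree 0 returns
   that fractional part.  So F_h runs through one step of T in deg A_{k+1} + 1
   steps, and for d_k + k <= l <= d_{k+1} + k the determinant formula gives
   - deg (f - U_l/V_l) between d_{k-1} + d_k and 2 d_{k+1}.  It remains to see
   that k/d_k tends to p = 1 - 1/q almost everywhere, for then the limit is
   - 2/(1 + p).  The number of k >= 1 with d_k <= N is binomial with parameters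
   N and p; only the upper bound for its law is needed, and this is obtained by
   covering with balls around the convergents.  A Chernoff bound and the
   Borel-Cantelli lemma conclude. *)

(** * Degrees in F((t^-1)) *)

Section LaurentDegree.
Context {F : fieldType}.
Implicit Types (f g h : laurent F) (m n : int).

Lemma lcoef0 i : (0 : laurent F) i = 0. Proof. by []. Qed.
Lemma lcoef1 i : (1 : laurent F) i = (i == 0)%:R. Proof. by []. Qed.
Lemma lcoefD f g i : (f + g) i = f i + g i. Proof. by []. Qed.
Lemma lcoefN f i : (- f) i = - f i. Proof. by []. Qed.
Lemma lcoefB f g i : (f - g) i = f i - g i. Proof. by []. Qed.

Lemma laurent_top_le f m n : laurent_top f m -> m <= n -> laurent_top f n.
Proof. by move=> tf mn i /(le_lt_trans mn)/tf. Qed.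

Lemma laurent_topD f g n :
  laurent_top f n -> laurent_top g n -> laurent_top (f + g) n.
Proof. by move=> tf tg i ni; rewrite lcoefD tf ?tg ?addr0. Qed.

Lemma laurent_topN f n : laurent_top f n -> laurent_top (- f) n.
Proof. by move=> tf i ni; rewrite lcoefN tf ?oppr0. Qed.

Lemma laurent_topM f g m n :
  laurent_top f m -> laurent_top g n -> laurent_top (f * g) (m + n).
Proof. exact: laurent_conv_top. Qed.

Lemma lead_at_top f n : lead_at f n -> laurent_top f n.
Proof. by case. Qed.

Lemma lead_at_neq0 f n : lead_at f n -> f != 0.
Proof. by case=> + _; apply: contraNneq => ->; rewrite lcoef0. Qed.

Lemma lead_at1 : lead_at (1 : laurent F) 0.
Proof.
split=> [|i i0]; rewrite lcoef1 ?eqxx ?oner_neq0 //.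
by rewrite gt_eqF.
Qed.

Lemma lead_at_uniq f m n : lead_at f m -> lead_at f n -> m = n.
Proof. by move=> /deg_lead fm /deg_lead; rewrite fm => -[]. Qed.

Lemma lead_atD f g m n :
  lead_at f m -> laurent_top g n -> n < m -> lead_at (f + g) m.
Proof.
move=> [fm tf] tg nm; split; first by rewrite lcoefD tg // addr0.
exact/laurent_topD/(laurent_top_le tg)/ltW.
Qed.

Lemma lead_atM f g m n :
  lead_at f m -> lead_at g n -> lead_at (f * g) (m + n).
Proof.
move=> [fm tf] [gn tg]; split; last exact: laurent_topM.
have := laurent_conv_trunc tf tg (ltnSn 0); rewrite subr0 => E.
have -> : (f * g) (m + n) = laurent_conv f g (m + n) by [].
by rewrite E coef0M !coef_poly /= !subr0 mulf_neq0.
Qed.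

Lemma lead_atV f n : lead_at f n -> lead_at f^-1 (- n).
Proof.
move=> fn; have f0 := lead_at_neq0 fn.
have [|m fm] := @lead_exists _ f^-1; first by rewrite invr_eq0.
suff -> : - n = m by [].
have := lead_atM fn fm; rewrite mulfV // => /lead_at_uniq/(_ lead_at1) nm0.
by apply/eqP; rewrite eq_sym -subr_eq0 opprK addrC nm0.
Qed.

Lemma lead_atN f n : lead_at f n -> lead_at (- f) n.
Proof.
move=> [fn tf]; split; last exact: laurent_topN.
by rewrite lcoefN oppr_eq0.
Qed.

Definition lpart f := laurent_of_poly (poly_part f).
(** [lfrac x^-1] is the Gauss map of the continued fraction expansion. *)
Definition lfrac f := f - lpart f.

Lemma lpartE f i : lpart f i = if 0 <= i then f i else 0.
Proof.
rewrite /lpart /= /poly_part.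
have [->|/lead_exists[d fd]] := eqVneq f 0.
  by rewrite deg0 coef0 lcoef0.
rewrite (deg_lead fd); case: ifP => // i0; rewrite coef_poly.
have -> : `|i|%N%:Z = i by lia.
case: ifP => // /negbT id; rewrite (lead_at_top fd) //; lia.
Qed.

Lemma lfracE f i : lfrac f i = if 0 <= i then 0 else f i.
Proof. by rewrite lcoefB lpartE; case: ifP; rewrite ?subrr ?subr0. Qed.

Lemma lfrac_top f : laurent_top (lfrac f) (-1).
Proof. by move=> i i1; rewrite lfracE ifT //; lia. Qed.

Lemma lpartD f g : lpart (f + g) = lpart f + lpart g.
Proof.
by apply: laurent_eqP => i; rewrite lcoefD !lpartE; case: ifP; rewrite ?addr0.
Qed.

Lemma lpart_lead f n : 0 <= n -> lead_at f n -> lead_at (lpart f) n.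
Proof.
move=> n0 [fn tf]; split; first by rewrite lpartE n0.
by move=> i ni; rewrite lpartE tf // if_same.
Qed.

Lemma lpart_eq0 f : laurent_top f (-1) -> lpart f = 0.
Proof.
move=> tf; apply: laurent_eqP => i; rewrite lpartE.
by case: ifP => // i0; rewrite tf //; lia.
Qed.

End LaurentDegree.

(** * The Farey map *)

Section FareyStep.
Context {F : fieldType} (h : laurent F) (h1 : lead_at h (-1)).
Implicit Types (f : laurent F) (d : int).

Lemma farey_partE f : farey_part h f = lpart f^-1 - lpart (h * f^-1).
Proof.
apply/eqP; rewrite eq_sym subr_eq -lpartD mulrBl mul1r; apply/eqP.
by congr lpart; rewrite subrK.
Qed.

(** As $|h|<1$, the factor $1-h$ has degree 0, so $(1-h)/f$ has the degree of $1/f$; this is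
    nonnegative and survives in the polynomial part. *)
Lemma farey_part_lead f d :
  d <= 0 -> lead_at f d -> lead_at (farey_part h f) (- d).
Proof.
move=> d0 fd; apply: lpart_lead; first by rewrite oppr_ge0.
rewrite -[- d]add0r; apply: lead_atM (lead_atV fd).
by apply: (lead_atD lead_at1 (laurent_topN (lead_at_top h1))).
Qed.

Lemma farey_neg f d : d < 0 -> lead_at f d ->
  farey h f = f / (1 - farey_part h f * f).
Proof.
by move=> d0 fd; rewrite /farey (deg_lead fd) lee_fin ifT //; lia.
Qed.

(** Inverting the definition gives $1/f-[(1-h)/f]$, where $[(1-h)/f]=[1/f]-[h/f]$. The right side is
    thus already split into fractional and polynomial part, from which the next two lemmas read off
    the degree and the fractional part of the new inverse. *)
Lemma farey_neg_inv f d : d < 0 -> lead_at f d ->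
  (farey h f)^-1 = lfrac f^-1 + lpart (h * f^-1).
Proof.
move=> d0 fd; rewrite (farey_neg d0 fd) invf_div mulrBl mul1r.
rewrite mulfK ?(lead_at_neq0 fd) // farey_partE /lfrac opprB addrA addrAC.
by [].
Qed.

(** This is where $\deg h=-1$ enters: $h/f$ has degree one less than $1/f$, which is still
    nonnegative, so $[h/f]$ dominates the fractional part. *)
Lemma farey_neg_lead f d :
  d < 0 -> lead_at f d -> lead_at (farey h f) (d + 1).
Proof.
move=> d0 fd; rewrite -[farey h f]invrK -[d + 1]opprK; apply: lead_atV.
rewrite (farey_neg_inv d0 fd) addrC; apply: (lead_atD _ (lfrac_top _)); last lia.
apply: lpart_lead; first lia.
have -> : - (d + 1) = -1 + - d by lia.
exact: lead_atM (lead_atV fd).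
Qed.

Lemma farey_neg_lfrac f d : d < 0 -> lead_at f d ->
  lfrac (farey h f)^-1 = lfrac f^-1.
Proof.
move=> d0 fd; rewrite (farey_neg_inv d0 fd); apply: laurent_eqP => i.
rewrite !lfracE lcoefD lpartE lfracE; by case: ifP => // i0; rewrite i0 addr0.
Qed.

Lemma farey_zero_part f : lead_at f 0 -> farey_part h f = lpart f^-1.
Proof.
move=> f0; rewrite farey_partE (@lpart_eq0 _ (h * _)) ?subr0 //.
rewrite -[-1]addr0 -oppr0; apply: laurent_topM; first exact: lead_at_top.
exact: lead_at_top (lead_atV f0).
Qed.

Lemma farey_zero f : lead_at f 0 -> farey h f = lfrac f^-1.
Proof.
move=> f0; rewrite /farey (deg_lead f0) lee_fin mulrBl mul1r.
by rewrite mulfK ?(lead_at_neq0 f0) // farey_zero_part.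
Qed.

Lemma farey_prodS f l i j : farey_prod h f l.+1 i j =
  farey_prod h f l i 0 * farey_mx h (iter l (farey h) f) 0 j +
  farey_prod h f l i 1 * farey_mx h (iter l (farey h) f) 1 j.
Proof.
rewrite /farey_prod big_ord_recr /= mxE big_ord_recl big_ord1.
by rewrite (_ : lift ord0 ord0 = 1) //; exact: val_inj.
Qed.

End FareyStep.

Section FareyOrbit.
Context {F : fieldType} (h : laurent F) (h1 : lead_at h (-1)).
Variables (f : laurent F) (a : nat -> nat).
Let gauss x : laurent F := lfrac x^-1.
Hypothesis a_gt0 : forall k, (0 < a k)%N.
Hypothesis a_lead : forall k, lead_at (iter k gauss f) (- (a k)%:Z).
Let d k := (\sum_(i < k) a i)%N.

(** The invariant of the orbit: at time l, k Gauss steps are complete and j Farey steps of the next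
    one are done. [M 1 0] is $V_l$, and f is the image of [fl] under the Moebius transformation of
    [M]. At j = 0 the first column still belongs to the previous convergent, or has $V_l=0$ if k =
    0; from j = 1 on its degree is that of the next one. *)
Variant farey_state (l : nat) : Prop :=
  FareyState k j of l = (d k + k + j)%N & (j <= a k)%N &
  let fl := iter l (farey h) f in
  let M := farey_prod h f l in
  [/\ lead_at fl (- (a k - j)%N%:Z), lfrac fl^-1 = iter k.+1 gauss f,
    if j is _.+1 then lead_at (M 1 0) (d k.+1)%:Z
      else if k is k'.+1 then lead_at (M 1 0) (d k')%:Z else M 1 0 = 0,
    lead_at (M 1 1) (d k)%:Z &
    [/\ lead_at (M 1 0 * fl + M 1 1) (d k + j)%N%:Z,
      f * (M 1 0 * fl + M 1 1) = M 0 0 * fl + M 0 1 &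
      M 0 0 * M 1 1 - M 0 1 * M 1 0 = 1 \/
      M 0 0 * M 1 1 - M 0 1 * M 1 0 = -1]].

Lemma dS k : d k.+1 = (d k + a k)%N.
Proof. by rewrite /d big_ord_recr. Qed.

Lemma farey_stateP l : farey_state l.
Proof.
elim: l => [|l [k j El jk [flead flfrac]]].
  apply: (@FareyState 0 0 0) => //; first by rewrite /d big_ord0.
  have E i j : farey_prod h f 0 i j = (i == j)%:R.
    by rewrite /farey_prod big_ord0 mxE.
  have E00 : farey_prod h f 0 0 0 = 1 by rewrite E.
  have E01 : farey_prod h f 0 0 1 = 0 by rewrite E.
  have E10 : farey_prod h f 0 1 0 = 0 by rewrite E.
  have E11 : farey_prod h f 0 1 1 = 1 by rewrite E.
  rewrite /= E00 E01 E10 E11 mul0r !mulr0 subr0 !mul1r add0r addr0.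
  split=> //; first by rewrite subn0; exact: (a_lead 0).
  - by rewrite /d big_ord0; exact: lead_at1.
  split; first by rewrite /d big_ord0; exact: lead_at1.
  - by rewrite mulr1.
  - by left.
have := @farey_prodS _ h f l; set M := farey_prod h f l.
set fl := iter l (farey h) f in flead flfrac *.
move=> MS Vlead V'lead [Wlead fE det].
have fl0 := lead_at_neq0 flead.
case: (ltnP j (a k)) => ja.
  have neg : - (a k - j)%N%:Z < 0 by lia.
  have mx i j' : farey_mx h fl i j' =
      if i == 0 then (if j' == 0 then 1 else 0)
      else (if j' == 0 then farey_part h fl else 1).
    by rewrite mxE (deg_lead flead) lte_fin neg.
  have partlead := farey_part_lead h1 (ltW neg) flead.
  have fS := farey_neg h neg flead.
  have nz : 1 - farey_part h fl * fl != 0.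
    have := lead_at_neq0 (farey_neg_lead h1 neg flead).
    by rewrite fS mulf_eq0 negb_or invr_eq0 => /andP[].
  apply: (@FareyState l.+1 k j.+1) => //; first by rewrite El addnS.
  rewrite /= -/fl !MS !mx /= !mulr1 !mulr0 !add0r.
  split => //.
  - have -> : - (a k - j.+1)%N%:Z = - (a k - j)%N%:Z + 1 by lia.
    exact: farey_neg_lead.
  - by rewrite (farey_neg_lfrac h neg flead).
  (* In the first step of a block the added term has degree $d_k+a_k=d_{k+1}$ and dominates; in
     later steps [M 1 0] already has this degree and the added term is smaller. *)
  - have bl := lead_atM V'lead partlead.
    case: j {El mx neg partlead fS jk} ja Vlead flead Wlead bl
      => [|j] ja Vlead flead Wlead bl.
      have -> : (d k.+1)%:Z = (d k)%:Z + - - (a k - 0)%N%:Z.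
        by rewrite dS opprK; lia.
      case: k {flfrac} V'lead Vlead bl ja flead Wlead
        => [|k] V'lead Vlead bl ja flead Wlead.
        by rewrite Vlead add0r.
      rewrite addrC; apply: (lead_atD bl (lead_at_top Vlead)).
      by rewrite dS; lia.
    apply: (lead_atD Vlead (lead_at_top bl)); rewrite dS; lia.
  (* Numerator and denominator of the Moebius image are multiplied by the same factor
     [farey h fl / fl], of degree 1. *)
  - have E : (M 1 0 + M 1 1 * farey_part h fl) * farey h fl + M 1 1 =
        (M 1 0 * fl + M 1 1) * (farey h fl / fl).
      by rewrite fS; field; rewrite fl0 nz.
    have E' : (M 0 0 + M 0 1 * farey_part h fl) * farey h fl + M 0 1 =
        (M 0 0 * fl + M 0 1) * (farey h fl / fl).
      by rewrite fS; field; rewrite fl0 nz.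
    split; rewrite ?E ?E'.
    + have -> : (d k + j.+1)%N%:Z = (d k + j)%N%:Z +
          ((- (a k - j)%N%:Z + 1) + - - (a k - j)%N%:Z) by lia.
      apply: lead_atM => //; apply: lead_atM (lead_atV flead).
      exact: farey_neg_lead.
    + by rewrite mulrA fE.
    + rewrite (_ : _ - _ = M 0 0 * M 1 1 - M 0 1 * M 1 0) //; ring.
(* The step at degree 0 completes the Gauss step: it moves the second column of [M] to the first,
   and the determinant changes sign. *)
have {ja}jE : j = a k by apply/eqP; rewrite eqn_leq jk.
rewrite jE subnn oppr0 in flead.
have mx i j' : farey_mx h fl i j' =
    if i == 0 then (if j' == 0 then 0 else 1)
    else (if j' == 0 then 1 else farey_part h fl).
  by rewrite mxE (deg_lead flead) lte_fin ltxx.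
have partlead := farey_part_lead h1 (lexx 0) flead.
rewrite oppr0 in partlead.
have fS : farey h fl = lfrac fl^-1 by exact: farey_zero.
have fS' : farey h fl = fl^-1 - farey_part h fl.
  by rewrite fS (farey_zero_part h1 flead).
apply: (@FareyState l.+1 k.+1 0) => //; first by rewrite El jE dS; lia.
rewrite /= -/fl !MS !mx /= !mulr1 !mulr0 !add0r.
split => //.
- by rewrite subn0 fS flfrac; exact: a_lead.
- by rewrite fS flfrac.
(* As $a_k>0$, at least one step of the block was made, so [M 1 0] already has degree $d_{k+1}$ and
   dominates the term of degree $d_k$. *)
- have [j' Ej] : exists j', j = j'.+1.
    by case: (j) jE (a_gt0 k) => [<- //|j' _ _]; exists j'.
  rewrite Ej in Vlead.
  apply: (lead_atD Vlead (lead_at_top (lead_atM V'lead partlead))).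
  by rewrite dS; have := a_gt0 k; lia.
- have E : M 1 1 * farey h fl + (M 1 0 + M 1 1 * farey_part h fl) =
      (M 1 0 * fl + M 1 1) / fl.
    by rewrite fS'; field.
  have E' : M 0 1 * farey h fl + (M 0 0 + M 0 1 * farey_part h fl) =
      (M 0 0 * fl + M 0 1) / fl.
    by rewrite fS'; field.
  split; rewrite ?E ?E'.
  + have -> : (d k.+1 + 0)%N%:Z = (d k + j)%N%:Z - 0 by rewrite dS jE; lia.
    exact: lead_atM (lead_atV flead).
  + by rewrite mulrA fE.
  + have -> : M 0 1 * (M 1 0 + M 1 1 * farey_part h fl) -
      (M 0 0 + M 0 1 * farey_part h fl) * M 1 1 =
      - (M 0 0 * M 1 1 - M 0 1 * M 1 0) by ring.
    by case: det => ->; [right | left; rewrite opprK].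
Qed.

(** By the determinant formula $f-U_l/V_l=\mp 1/(V_l W)$, where $W$ is [M 1 0 * fl + M 1 1], of
    degree $d_k+j$, and $\deg V_l$ is $d_{k-1}$ or $d_{k+1}$ according as j = 0 or not. *)
Lemma farey_approx_lead l : (0 < l)%N -> exists k e,
  [/\ (d k + k <= l <= d k.+1 + k)%N, (d k.-1 + d k <= e <= 2 * d k.+1)%N &
   lead_at (f - farey_num h f l / farey_den h f l) (- e%:Z)].
Proof.
case: (farey_stateP l) => k j El jk /=.
rewrite /farey_num /farey_den.
set M := farey_prod h f l; set fl := iter l _ f.
move=> [flead flfrac Vlead V'lead [Wlead fE det]] l0.
have [v [vb V]] : exists v : nat, (d k.-1 <= v <= d k.+1)%N /\ lead_at (M 1 0) v%:Z.
  case: j jk El Vlead {Wlead flead} => [|j] jk El Vlead.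
    case: k El Vlead {V'lead jk flfrac} => [|k] El Vlead.
      (* k = j = 0 means l = 0, the only time at which $V_l$ vanishes. *)
      by move: l0; rewrite El /d big_ord0.
    by exists (d k); split => //=; rewrite !dS; lia.
  exists (d k.+1); split => //; rewrite leqnn andbT.
  by case: (k) => [|k'] //=; rewrite ?dS; lia.
exists k, (v + (d k + j))%N; split.
- by rewrite El dS; lia.
- by move: vb; rewrite dS; lia.
have V0 := lead_at_neq0 V; have W0 := lead_at_neq0 Wlead.
have -> : f - M 0 0 / M 1 0 =
    - (M 0 0 * M 1 1 - M 0 1 * M 1 0) / (M 1 0 * (M 1 0 * fl + M 1 1)).
  apply/eqP; rewrite eq_sym -[eqbLHS]mulr1 -[X in _ * X](mulfV W0).
  rewrite [f](_ : _ = (M 0 0 * fl + M 0 1) / (M 1 0 * fl + M 1 1)); last first.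
    by rewrite -fE mulfK.
  by apply/eqP; field; rewrite V0 W0.
have -> : - (v + (d k + j))%N%:Z = 0 - (v%:Z + (d k + j)%N%:Z) by lia.
apply: lead_atM (lead_atV (lead_atM V Wlead)).
case: det => ->; rewrite ?opprK; first exact: lead_atN lead_at1.
exact: lead_at1.
Qed.

End FareyOrbit.

(** * Haar measure of balls *)

Section Ball.
Context {F : fieldType}.
Implicit Types (c f g : laurent F) (n : int).

(** The closed ball of radius $q^n$ around c. *)
Definition lball c n : set (laurent F) := [set f | laurent_top (f - c) n].

Lemma lballP c n f : lball c n f = laurent_top (f - c) n. Proof. by []. Qed.

Lemma lball0P n f : lball 0 n f = laurent_top f n.
Proof. by rewrite lballP subr0. Qed.

Lemma deg_lt_top f n : (deg f < n%:E)%E -> laurent_top f (n - 1).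
Proof.
have [->|/lead_exists[d fd]] := eqVneq f 0; first by [].
rewrite (deg_lead fd) lte_fin => dn.
by apply: (laurent_top_le (lead_at_top fd)); lia.
Qed.

Lemma lball_measurable c n : measurable (lball c n).
Proof.
apply: sub_sigma_algebra.
suff: laurent_open (lball c n) by [].
move=> f fc; exists (n + 1) => g /deg_lt_top.
rewrite addrK => gf.
have E : g - c = (g - f) + (f - c) by rewrite addrA subrK.
change (laurent_top (g - c) n); rewrite E; exact: laurent_topD.
Qed.

Lemma lball_translate c n : lball c n = [set c + g | g in lball 0 n].
Proof.
apply/seteqP; split=> [f fc|_ [g + <-]].
  exists (f - c); last by rewrite addrC subrK.
  by rewrite lball0P.
by rewrite lball0P lballP addrAC subrr add0r.
Qed.

Lemma monomial_supp (a : F) n :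
  bounded_above_supp (fun i => if i == n then a else 0).
Proof. by exists n => i; case: ifP => // /eqP ->; rewrite ltxx. Qed.

Definition monomial a n := Laurent (monomial_supp a n).

Lemma lball_split n :
  lball 0 (n + 1) = \bigcup_(a in [set: F]) lball (monomial a (n + 1)) n.
Proof.
apply/seteqP; split=> f.
  rewrite lball0P => tf; exists (f (n + 1)) => //; rewrite lballP => i ni.
  rewrite lcoefB /=; case: eqP => [->|ne]; first by rewrite subrr.
  by rewrite subr0 tf //; lia.
move=> [a _]; rewrite lball0P lballP => tf i ni.
have := tf i; rewrite lcoefB /= ifF ?subr0; first by apply; lia.
by apply/negP => /eqP; lia.
Qed.

Lemma lball_trivIset n :
  trivIset [set: F] (fun a => lball (monomial a (n + 1)) n).
Proof.
move=> a b _ _ [f [+ +]]; rewrite !lballP => fa fb.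
have n1 : n < n + 1 by lia.
have := fb _ n1; have := fa _ n1; rewrite !lcoefB /= eqxx.
by move=> /eqP; rewrite subr_eq0 => /eqP -> /eqP; rewrite subr_eq0 => /eqP.
Qed.

End Ball.

Section HaarBall.
Context {R : realType} {F : finFieldType}.
Variable mu : {measure set (laurent F) -> \bar R}.
Hypothesis hmu : normalized_haar mu.
Let q : R := #|F|%:R.

Lemma card_field_gt1 : 1 < q.
Proof. by rewrite ltr1n; exact: card_finNzRing_gt1. Qed.

Lemma unit_ballE : unit_ball R F = lball 0 0.
Proof.
apply/seteqP; split=> f; rewrite lball0P /unit_ball /absv /=;
  have [->|/lead_exists[d fd]] := eqVneq f 0.
- by [].
- rewrite (deg_lead fd) -(expr0z q) ler_eXz2l ?card_field_gt1 // => d0.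
  exact: laurent_top_le (lead_at_top fd) d0.
- by rewrite deg0.
- rewrite (deg_lead fd) -(expr0z q) ler_eXz2l ?card_field_gt1 // => tf.
  rewrite leNgt; apply/negP => /tf E.
  by case: fd; rewrite E eqxx.
Qed.

Lemma open_unit_ballE : open_unit_ball R F = lball 0 (-1).
Proof.
apply/seteqP; split=> f; rewrite lball0P /open_unit_ball /absv /=;
  have [->|/lead_exists[d fd]] := eqVneq f 0.
- by [].
- rewrite (deg_lead fd) -(expr0z q) ltr_eXz2l ?card_field_gt1 // => d0.
  by apply: laurent_top_le (lead_at_top fd) _; lia.
- by rewrite deg0.
- rewrite (deg_lead fd) -(expr0z q) ltr_eXz2l ?card_field_gt1 // => tf.
  rewrite ltNge; apply/negP => d0; have /tf E : -1 < d by lia.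
  by case: fd; rewrite E eqxx.
Qed.

Lemma haar_lballE c n : mu (lball c n) = mu (lball 0 n).
Proof.
rewrite lball_translate; apply: hmu.1; exact: lball_measurable.
Qed.

(** The coefficient at n + 1 splits the larger ball into q disjoint translates of the smaller
    one. *)
Lemma haar_lballS n : mu (lball 0 (n + 1)) = (q%:E * mu (lball 0%R n))%E.
Proof.
rewrite lball_split measure_fin_bigcup; last 3 first.
- exact: finite_finset.
- exact: lball_trivIset.
- by move=> a _; exact: lball_measurable.
rewrite (eq_fsbigr (fun=> mu (lball 0 n))); last first.
  by move=> a _; exact: haar_lballE.
rewrite (@fsbigE _ _ _ _ _ (enum F)) ?enum_uniq //; last first.
  by move=> a _; rewrite mem_enum.
under eq_bigl do rewrite in_setT.
by rewrite big_enum /= sumr_const /q mule_natl.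
Qed.

Lemma haar_lball c (m : nat) : mu (lball c (- m%:Z)) = (q^-1 ^+ m)%:E.
Proof.
rewrite haar_lballE; elim: m => [|m IH].
  by rewrite oppr0 -unit_ballE hmu.2 expr0.
have := haar_lballS (- m.+1%:Z).
have -> : - m.+1%:Z + 1 = - m%:Z by lia.
have q0 : q != 0 by rewrite gt_eqF // (lt_trans _ card_field_gt1).
by rewrite IH => E; rewrite exprS EFinM E muleA -EFinM mulVf // mul1e.
Qed.

End HaarBall.

(** * The law of the number of convergents of bounded degree *)

Section CoverBound.
Context {d : measure_display} {T : measurableType d} {R : realType}.
Variable mu : {measure set T -> \bar R}.
Implicit Types (A S : set T) (c : R).

(** A bound on the outer measure of S; it lets sets given by [cf_count] be estimated through
    measurable covers. *)
Definition coverable S c :=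
  exists A, [/\ measurable A, S `<=` A & (mu A <= c%:E)%E].

Lemma coverableW S S' c c' :
  S' `<=` S -> c <= c' -> coverable S c -> coverable S' c'.
Proof.
move=> SS cc [A [mA SA Ac]]; exists A; split=> //.
  exact: subset_trans SA.
by rewrite (le_trans Ac) ?lee_fin.
Qed.

Lemma coverable_bigsetU (I : finType) (P : pred I) (S : I -> set T) (c : I -> R) :
  (forall i, P i -> coverable (S i) (c i)) ->
  coverable (\big[setU/set0]_(i | P i) S i) (\sum_(i | P i) c i).
Proof.
move=> Sc; apply: (big_ind2 coverable) => //.
  by exists set0; split=> //; rewrite measure0.
move=> S1 c1 S2 c2 [A1 [mA1 SA1 Ac1]] [A2 [mA2 SA2 Ac2]].
exists (A1 `|` A2); split; first exact: measurableU.
  exact: setUSS.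
by rewrite EFinD; apply: le_trans (measureU2 _ mA1 mA2) (leeD Ac1 Ac2).
Qed.

Lemma coverable_exists (I : finType) (P : pred I) (S : I -> set T) S'
    (c : I -> R) :
  (forall i, P i -> coverable (S i) (c i)) ->
  (forall x, S' x -> exists2 i, P i & S i x) ->
  coverable S' (\sum_(i | P i) c i).
Proof.
move=> Sc SS; apply: coverableW (lexx _) (coverable_bigsetU Sc) => x.
by move=> /SS[i Pi Six]; rewrite (bigD1 i) //=; left.
Qed.

End CoverBound.

Section BinomialWeight.
Context {R : comNzRingType}.
Variables (p r : R).

(** The binomial weight $\binom{N}{k}p^kr^{N-k}$, read off its generating polynomial so that the
    recursions come from multiplication by one factor. *)
Definition binw (N k : nat) : R := ((r%:P + p *: 'X) ^+ N)`_k.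

Lemma binw0 k : binw 0 k = (k == 0)%:R.
Proof. by rewrite /binw expr0 coef1. Qed.

Lemma binwS0 N : binw N.+1 0 = r * binw N 0.
Proof.
by rewrite /binw exprS mulrDl coefD coefCM -scalerAl coefZ coefXM mulr0 addr0.
Qed.

Lemma binwSS N k : binw N.+1 k.+1 = r * binw N k.+1 + p * binw N k.
Proof. by rewrite /binw exprS mulrDl coefD coefCM -scalerAl coefZ coefXM. Qed.

Lemma binwN0 N : binw N 0 = r ^+ N.
Proof. by elim: N => [|N IH]; rewrite ?binw0 // binwS0 IH exprS. Qed.

(* Decomposition of N independent trials according to the first success. *)
Lemma binw_first N k :
  binw N k.+1 = \sum_(n < N) p * r ^+ n * binw (N - n.+1) k.
Proof.
elim: N => [|N IH]; first by rewrite big_ord0 binw0.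
rewrite big_ord_recl binwSS IH addrC expr0 mulr1 subn1; congr (_ + _).
rewrite mulr_sumr; apply: eq_bigr => n _ /=.
by rewrite subSS exprS; ring.
Qed.

Lemma binw_sum N z : \sum_(k < N.+1) binw N k * z ^+ k = (r + p * z) ^+ N.
Proof.
set P := (r%:P + p *: 'X).
have -> : (r + p * z) = P.[z] by rewrite hornerD hornerC hornerZ hornerX.
rewrite -horner_exp (@horner_coef_wide _ N.+1) //.
apply: leq_trans (size_poly_exp_leq _ _) _; rewrite ltnS.
have : (size P <= 2)%N.
  apply: leq_trans (size_polyD _ _) _; rewrite geq_max.
  rewrite (leq_trans (size_polyC_leq1 _)) //.
  by rewrite (leq_trans (size_scale_leq _ _)) // size_polyX.
by case: (size P) => [|[|[|]]] //= _; rewrite ?mul0n ?mul1n.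
Qed.

End BinomialWeight.

Lemma binw_ge0 (R : numDomainType) (p r : R) N k :
  0 <= p -> 0 <= r -> 0 <= binw p r N k.
Proof.
move=> p0 r0; elim: N k => [|N IH] k; first by rewrite binw0 ler0n.
case: k => [|k]; first by rewrite binwS0 mulr_ge0.
by rewrite binwSS addr_ge0 ?mulr_ge0.
Qed.

Section ContinuedFractionCount.
Context {F : fieldType}.

(* [cf_count N k x]: exactly k of the convergent denominators Q_1, Q_2, ... of
   x have degree at most N. *)
Inductive cf_count : nat -> nat -> laurent F -> Prop :=
| cf_count0 N (x : laurent F) : laurent_top x (- N.+1%:Z) -> cf_count N 0 x
| cf_countS N k n (x : laurent F) : lead_at x (- n.+1%:Z) ->
    cf_count N k (lfrac x^-1) -> cf_count (n.+1 + N) k.+1 x.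

Lemma cf_count_le N k x : cf_count N k x -> (k <= N)%N.
Proof. by elim=> // {}N {}k n {}x _ _; lia. Qed.

(** A finite index set for the possible partial quotients of degree n + 1; the leading digit is kept
    apart so that the exact degree is the condition [u.1 != 0]. *)
Definition poly_of_digits n (u : F * {ffun 'I_n.+1 -> F}) : laurent F :=
  laurent_of_poly
    (\poly_(i < n.+2) if i == n.+1 then u.1 else u.2 (inord i)).

Lemma poly_of_digitsP n x : lead_at x n.+1%:Z ->
  exists2 u, u.1 != 0 & lpart x = poly_of_digits (n := n) u.
Proof.
move=> xn; exists (x n.+1%:Z, [ffun i : 'I_n.+1 => x i%:Z]); first by case: xn.
apply: laurent_eqP => i; rewrite lpartE /poly_of_digits /=.
case: ifP => // i0; rewrite coef_poly.
have Ei : `|i|%N%:Z = i by lia.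
case: ltnP => [il|il]; last by rewrite (lead_at_top xn) //; lia.
case: eqP => [E|ne]; first by rewrite -E Ei.
by rewrite ffunE inordK ?Ei //; lia.
Qed.

End ContinuedFractionCount.

Section CountCover.
Context {R : realType} {F : finFieldType}.
Variable mu : {measure set (laurent F) -> \bar R}.
Hypothesis hmu : normalized_haar mu.
Let q : R := #|F|%:R.
Let r := q^-1.
Let p := 1 - r.

(** Induction on N, peeling off the first partial quotient; general Moebius transformations of
    determinant $\pm1$ are needed to absorb it. The factor $r^{2d+1}$ is the measure of the image of
    the open unit ball, and the recursion matches [binw_first]. *)
Lemma cf_count_cover N k (d : nat) (p1 p0 q1 q0 : laurent F) :
  lead_at q0 d%:Z -> laurent_top q1 (d%:Z - 1) ->
  p1 * q0 - p0 * q1 = 1 \/ p1 * q0 - p0 * q1 = -1 ->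
  coverable mu [set f | exists x : laurent F, [/\ laurent_top x (-1), cf_count N k x &
      f = (p1 * x + p0) / (q1 * x + q0)]]
    (r ^+ (2 * d + 1) * binw p r N k).
Proof.
elim/ltn_ind: N k d p1 p0 q1 q0 => N IH k d p1 p0 q1 q0 q0d q1d det.
have den (y : laurent F) : laurent_top y (-1) -> lead_at (q1 * y + q0) d%:Z.
  move=> y1; rewrite addrC; apply: (lead_atD q0d (laurent_topM q1d y1)); lia.
case: k => [|k].
  (* With no convergent of degree at most N, x has degree at most $-(N+1)$, and the determinant
     formula places its image in this ball. *)
  exists (lball (p0 / q0) (- (2 * d + N.+1)%N%:Z)); split.
  - exact: lball_measurable.
  - move=> _ [x [x1 xN ->]]; rewrite lballP.
    have {}xN : laurent_top x (- N.+1%:Z) by inversion xN.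
    have E : (p1 * x + p0) / (q1 * x + q0) - p0 / q0 =
        (p1 * q0 - p0 * q1) * x * ((q1 * x + q0)^-1 / q0).
      by field; rewrite (lead_at_neq0 q0d) (lead_at_neq0 (den _ x1)).
    rewrite E.
    have -> : - (2 * d + N.+1)%N%:Z = 0 - N.+1%:Z + (- d%:Z - d%:Z) by lia.
    apply: laurent_topM.
      apply: laurent_topM => //.
      case: det => ->; first exact: lead_at_top lead_at1.
      exact: lead_at_top (lead_atN lead_at1).
    exact: lead_at_top (lead_atM (lead_atV (den _ x1)) (lead_atV q0d)).
  - by rewrite haar_lball // binwN0 -exprD (_ : (2 * d + 1 + N = 2 * d + N.+1)%N) //; lia.
rewrite binw_first mulr_sumr.
pose S (n : 'I_N) := [set f | exists x : laurent F, [/\ laurent_top x (-1),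
  lead_at x (- n.+1%:Z), cf_count (N - n.+1) k (lfrac x^-1) &
  f = (p1 * x + p0) / (q1 * x + q0)]].
apply: (@coverable_exists _ _ _ mu _ predT S); last first.
  move=> f [x [x1 xN Ef]].
  inversion xN as [|N' k' n y xn xc EN Ek Ey].
  have nN : (n < N)%N by lia.
  exists (Ordinal nN) => //; exists x; split=> //=.
  by have -> : (N - n.+1 = N')%N by lia.
move=> [n nN] _ /=.
(* Put $x=1/(A+y)$ with $A$ the polynomial of digits u. The image of x is that of y under a new
   transformation, whose denominator entry $q_1+q_0A$ has degree $d+n+1$. *)
pose Su (u : F * {ffun 'I_n.+1 -> F}) := [set f | exists x : laurent F,
  [/\ laurent_top x (-1), cf_count (N - n.+1) k x &
  f = (p0 * x + (p1 + p0 * poly_of_digits u)) /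
      (q0 * x + (q1 + q0 * poly_of_digits u))]].
(* There are $(q-1)q^{n+1}$ polynomials of degree n + 1, and $(q-1)q^{n+1}r^{2(n+1)}=pr^n$. *)
have Sum : r ^+ (2 * d + 1) * (p * r ^+ n * binw p r (N - n.+1) k) =
    \sum_(u : F * {ffun 'I_n.+1 -> F} | u.1 != 0)
      r ^+ (2 * (d + n.+1) + 1) * binw p r (N - n.+1) k.
  rewrite (eq_bigl (fun u : F * {ffun 'I_n.+1 -> F} =>
      (u.1 != 0) && predT u.2));
    last by move=> u; rewrite andbT.
  rewrite -(pair_big (fun a : F => a != 0) predT
    (fun _ _ => r ^+ (2 * (d + n.+1) + 1) * binw p r (N - n.+1) k)) /=.
  have q0' : q != 0 by rewrite gt_eqF // (lt_trans _ (card_field_gt1)).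
  have sum_tail (c : R) :
      \sum_(v : {ffun 'I_n.+1 -> F}) c = c *+ #|F| ^ n.+1.
    by rewrite sumr_const card_ffun card_ord.
  have sum_head (c : R) : \sum_(a : F | a != 0) c = c *+ #|F|.-1.
    by rewrite (sumr_const (predC1 (0 : F))) cardC1.
  rewrite sum_tail sum_head -mulrnA -mulr_natr.
  rewrite natrM natrX -subn1 natrB; last exact: ltnW (card_finNzRing_gt1 F).
  rewrite -/q /p.
  have -> : (2 * (d + n.+1) + 1 = 2 * d + 1 + (n + n.+1) + 1)%N by lia.
  rewrite !exprD expr1 (_ : 1 - r = r * (q - 1)); last first.
    by rewrite mulrBr mulr1 mulVf.
  have qr : q ^+ n.+1 * r ^+ n.+1 = 1 by rewrite -exprMn mulfV // expr1n.
  rewrite -[LHS]mulr1 -qr; ring.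
rewrite Sum.
apply: (@coverable_exists _ _ _ mu _ _ Su).
  move=> u u0; apply: IH; first lia.
  - have un : lead_at (poly_of_digits u) n.+1%:Z.
      split; rewrite /poly_of_digits /=.
        by rewrite coef_poly ltnSn eqxx.
      move=> i ni; rewrite ifT; last lia.
      by rewrite coef_poly ifF //; lia.
    rewrite addrC (_ : (d + n.+1)%N%:Z = d%:Z + n.+1%:Z); last lia.
    by apply: (lead_atD (lead_atM q0d un) q1d); lia.
  - by apply: laurent_top_le (lead_at_top q0d) _; lia.
  - rewrite (_ : p0 * _ - _ = - (p1 * q0 - p0 * q1)); last by ring.
    by case: det => ->; [right | left; rewrite opprK].
move=> f [x [x1 xn xc ->]].
have xVn : lead_at x^-1 n.+1%:Z by rewrite -[n.+1%:Z]opprK; exact: lead_atV.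
have [u u0 uE] := poly_of_digitsP xVn.
exists u => //; exists (lfrac x^-1); split=> //; first exact: lfrac_top.
have x0 := lead_at_neq0 xn.
have E : lfrac x^-1 = x^-1 - poly_of_digits u by rewrite /lfrac uE.
rewrite E.
have den0 := lead_at_neq0 (den _ x1).
have -> : p0 * (x^-1 - poly_of_digits u) + (p1 + p0 * poly_of_digits u) =
  (p1 * x + p0) / x by field.
have -> : q0 * (x^-1 - poly_of_digits u) + (q1 + q0 * poly_of_digits u) =
  (q1 * x + q0) / x by field.
by field; rewrite x0 den0.
Qed.

(** The identity transformation, with d = 0; the remaining factor r, the measure of the open unit
    ball, is bounded by 1. *)
Lemma cf_count_unit_cover N k :
  coverable mu [set f : laurent F | laurent_top f (-1) /\ cf_count N k f]
    (binw p r N k).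
Proof.
have [||A [mA SA Ac]] := @cf_count_cover N k 0 1 0 0 1 lead_at1.
- by [].
- by left; rewrite mulr1 mulr0 subr0.
exists A; split=> //.
  move=> f [f1 fc]; apply: SA; exists f; split=> //.
  by rewrite mul1r mul0r addr0 add0r divr1.
have q1 := @card_field_gt1 R F.
have r1 : r <= 1 by rewrite invf_le1 // ?ltW // (lt_trans _ q1).
have r0 : 0 <= r by rewrite invr_ge0 ler0n.
rewrite expr1 in Ac; apply: le_trans Ac _; rewrite lee_fin.
have p0 : 0 <= p by rewrite subr_ge0.
by rewrite ler_piMl // binw_ge0.
Qed.

End CountCover.

(** * Large deviations *)

Section Chernoff.
Context {R : realType}.
Implicit Types (p r s e : R).

(** One has $e^s\le 1/(1-s)$, and $(1-s)(1+s+2s^2)=1+s^2(1-2s)$. *)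
Lemma expR_le_quadratic s : s <= 2^-1 -> expR s <= 1 + s + 2 * s ^+ 2.
Proof.
move=> s2; have s1 : 0 < 1 - s by lra.
have : expR s <= (1 - s)^-1.
  rewrite -[expR s]invrK -expRN lef_pV2 ?posrE ?expR_gt0 //.
  exact: expR_ge1Dx.
move=> /le_trans; apply; rewrite -[leLHS]mul1r ler_pdivrMr //.
have : 0 <= s ^+ 2 * (1 - 2 * s) by rewrite mulr_ge0 ?sqr_ge0 //; lra.
nra.
Qed.

Lemma bernoulli_mgf_le p r s : 0 <= p -> 0 <= r -> p + r = 1 -> s <= 2^-1 ->
  r + p * expR s <= expR (p * s + 2 * s ^+ 2).
Proof.
move=> p0 r0 pr s2; apply: le_trans (expR_ge1Dx _).
have := ler_wpM2l p0 (expR_le_quadratic s2).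
have : 0 <= r * (2 * s ^+ 2) by rewrite mulr_ge0 // mulr_ge0 // sqr_ge0.
have -> : r = 1 - p by lra.
nra.
Qed.

Lemma binomial_tail p r e N : 0 <= p -> 0 <= r -> p + r = 1 -> 0 < e -> e <= 1 ->
  \sum_(k < N.+1 | e * N%:R <= `|k%:R - p * N%:R|) binw p r N k <=
  2 * expR (- (e ^+ 2 / 8)) ^+ N.
Proof.
(* The choice $s=e/4$ minimizes the Chernoff exponent $-se+2s^2$, with value $-e^2/8$. The moments
   [w s] and [w (- s)] bound the upper and the lower tail. *)
move=> p0 r0 pr e0 e1; pose s := e / 4.
have b0 k := @binw_ge0 _ p r N k p0 r0.
pose w t := expR (- (t * p + s * e) * N%:R) * (r + p * expR t) ^+ N.
have mgf t : w t =
    \sum_(k < N.+1) binw p r N k * expR (t * (k%:R - p * N%:R) - s * e * N%:R).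
  rewrite /w -binw_sum mulr_sumr; apply: eq_bigr => k _.
  rewrite mulrCA -expRM_natr -expRD; congr (_ * expR _); ring.
have wle t : t <= 2^-1 -> t ^+ 2 = s ^+ 2 -> w t <= expR (- (e ^+ 2 / 8)) ^+ N.
  move=> t2 ts; rewrite /w.
  have step : (r + p * expR t) ^+ N <= expR (p * t + 2 * t ^+ 2) ^+ N.
    apply: lerXn2r; rewrite ?nnegrE ?expR_ge0 ?bernoulli_mgf_le //.
    by rewrite addr_ge0 // mulr_ge0 ?expR_ge0.
  apply: le_trans (ler_wpM2l (expR_ge0 _) step) _.
  rewrite expRM_natr -exprMn -expRD ts /s.
  by rewrite (_ : _ + _ = - (e ^+ 2 / 8)) //; field.
apply: (@le_trans _ _ (w s + w (- s))); last first.
  rewrite mulr_natl mulr2n; apply: lerD; apply: wle; rewrite ?sqrrN // /s; lra.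
rewrite !mgf -big_split /= [leRHS](bigID (fun k : 'I_N.+1 =>
  e * N%:R <= `|k%:R - p * N%:R|)) /=.
rewrite -[leLHS]addr0; apply: lerD; last first.
  by apply: sumr_ge0 => k _; rewrite -mulrDr mulr_ge0 ?addr_ge0 ?expR_ge0.
apply: ler_sum => k; rewrite -mulrDr => kN; rewrite ler_peMr //.
have s0 : 0 < s by rewrite /s; lra.
have ge1 (x : R) : 0 <= x -> 1 <= expR x by rewrite -expR0 ler_expR.
move: kN; rewrite ler_normr => /orP[] kN.
  apply: ler_wpDr (expR_ge0 _) _.
  by apply: ge1; rewrite subr_ge0 -mulrA ler_pM2l.
apply: ler_wpDl (expR_ge0 _) _.
by apply: ge1; rewrite subr_ge0 -mulrA mulNr -mulrN ler_pM2l.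
Qed.

End Chernoff.

Section Negligible.
Context {R : realType} {F : finFieldType}.
Variable mu : {measure set (laurent F) -> \bar R}.
Hypothesis hmu : normalized_haar mu.
Let p : R := 1 - #|F|%:R^-1.

Definition count_deviates (e : R) N : set (laurent F) :=
  [set f : laurent F | laurent_top f (-1) /\
    exists2 k, cf_count N k f & e * N%:R <= `|k%:R - p * N%:R|].

Lemma count_deviates_cover (e : R) N : 0 < e -> e <= 1 ->
  coverable mu (count_deviates e N) (2 * expR (- (e ^+ 2 / 8)) ^+ N).
Proof.
move=> e0 e1.
have q1 := @card_field_gt1 R F.
have r1 : #|F|%:R^-1 <= 1 :> R by rewrite invf_le1 // ?ltW // (lt_trans _ q1).
have r0 : 0 <= #|F|%:R^-1 :> R by rewrite invr_ge0 ler0n.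
have p0 : 0 <= p by rewrite subr_ge0.
have tail := binomial_tail N p0 r0 (subrK _ _) e0 e1.
apply: (coverableW (@subset_refl _ _) tail).
apply: (@coverable_exists _ _ _ mu _ _
  (fun k : 'I_N.+1 => [set f : laurent F | laurent_top f (-1) /\ cf_count N k f])).
  by move=> k _; exact: cf_count_unit_cover.
move=> f [f1 [k fk dev]].
by exists (inord k); rewrite /= inordK // ltnS; exact: cf_count_le fk.
Qed.

Lemma count_deviates_negligible (e : R) : 0 < e -> e <= 1 ->
  mu.-negligible (lim_sup_set (count_deviates e)).
Proof.
move=> e0 e1; pose rho := expR (- (e ^+ 2 / 8)).
have rho0 : 0 < rho by exact: expR_gt0.
have rho1 : `|rho| < 1.
  by rewrite gtr0_norm // expR_lt1 oppr_lt0 divr_gt0 // exprn_gt0.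
(* Borel-Cantelli is applied to measurable covers, whose measures are bounded by a geometric
   sequence. *)
have [A AP] := choice (fun N => count_deviates_cover N e0 e1).
exists (lim_sup_set A); split.
- apply: bigcap_measurable => // n _; apply: bigcup_measurable => k _.
  by have [] := AP k.
- apply: lim_sup_set_cvg0 => [k|]; first by have [] := AP k.
  apply: (@le_lt_trans _ _ (2 * (1 - rho)^-1)%:E); last exact: ltry.
  apply: lime_le; first exact: is_cvg_nneseries.
  apply: nearW => n; apply: le_trans (_ : (series (geometric 2 rho) n)%:E <= _)%E.
    rewrite /series /= -sumEFin; apply: lee_sum => k _.
    by have [] := AP k.
  by rewrite lee_fin; apply: geometric_le_lim.
- move=> f fdev n _; have [k nk fk] := fdev n I; exists k => //.
  by have [_ + _] := AP k; apply.
Qed.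

End Negligible.

(** * Typical behaviour *)

Section RationalNegligible.
Context {R : realType} {F : finFieldType}.
Variable mu : {measure set (laurent F) -> \bar R}.
Hypothesis hmu : normalized_haar mu.

Lemma haar_set1_negligible (f : laurent F) : mu.-negligible [set f].
Proof.
exists (\bigcap_m lball f (- m%:Z)); split.
- by apply: bigcap_measurable => // m _; exact: lball_measurable.
- apply/eqP; rewrite eq_le measure_ge0 andbT; apply/lee_addgt0Pr => e e0.
  (* Then $1/e<2^m\le q^m$, so the ball of radius $q^{-m}$ has measure below e. *)
  pose m := Num.bound e^-1.
  have q2 : 2 <= #|F|%:R :> R by rewrite ler_nat card_finNzRing_gt1.
  have em : e^-1 < #|F|%:R ^+ m.
    apply: lt_le_trans (upper_nthrootP (leqnn m)) _.
    by apply: lerXn2r; rewrite ?nnegrE.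
  have mB : measurable (lball f (- m%:Z)) by exact: lball_measurable.
  rewrite add0e; apply: (@le_trans _ _ (mu (lball f (- m%:Z)))).
    apply: le_measure; rewrite ?inE //; last exact: bigcap_inf.
    by apply: bigcap_measurable => // k _; exact: lball_measurable.
  rewrite haar_lball // lee_fin exprVn -[e]invrK lef_pV2 ?posrE ?invr_gt0 //.
    exact: ltW.
  by rewrite exprn_gt0 // (lt_le_trans _ q2).
- by move=> g -> m _; rewrite lballP subrr.
Qed.

Lemma laurent_rational_negligible : mu.-negligible (@laurent_rational F).
Proof.
pose S n : set (laurent F) :=
  if unpickle n is Some pr then
    let: (p, r) := (pr : {poly F} * {poly F}) in
    [set laurent_of_poly p / laurent_of_poly r] else set0.
apply: (@negligibleS _ _ _ _ (\bigcup_n S n)).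
  move=> f [p [r [_ ->]]]; exists (pickle (p, r)) => //.
  by rewrite /S pickleK.
apply: negligible_bigcup => n; rewrite /S.
case: unpickle => [[p r]|]; first exact: haar_set1_negligible.
exact: negligible_set0.
Qed.

End RationalNegligible.

Section CountAsymptotics.
Context {F : fieldType}.
Let gauss (x : laurent F) : laurent F := lfrac x^-1.

(** A terminating expansion has finitely many convergents, so its count is eventually constant; this
    will contradict growth at rate p. *)
Lemma cf_count_terminating k (x : laurent F) :
  laurent_top x (-1) -> iter k gauss x = 0 ->
  exists j N0, forall N, (N0 <= N)%N -> cf_count N j x.
Proof.
elim: k x => [|k IH] x x1; first by move=> /= ->; exists 0, 0 => N _; exact: cf_count0.
have [-> _|x0] := eqVneq x 0; first by exists 0, 0 => N _; exact: cf_count0.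
rewrite iterSr => /IH[|j [N0 H]]; first exact: lfrac_top.
have [e xe] := lead_exists x0.
have e1 : e <= -1 by rewrite leNgt; apply/negP => /x1 E; case: xe; rewrite E eqxx.
have [n en] : exists n : nat, e = - n.+1%:Z by exists `|e|.-1; lia.
exists j.+1, (n.+1 + N0)%N => N nN.
have -> : N = (n.+1 + (N - n.+1))%N by lia.
by apply: cf_countS; [rewrite -en | apply: H; lia].
Qed.

(** At $N=d_k$ the count is exactly k, which turns count asymptotics into asymptotics of $k/d_k$. *)
Lemma cf_count_convergent (a : nat -> nat) k (x : laurent F) :
  (forall i, lead_at (iter i gauss x) (- (a i).+1%:Z)) ->
  cf_count (\sum_(i < k) (a i).+1) k x.
Proof.
elim: k a x => [|k IH] a x xa.
  rewrite big_ord0; apply: cf_count0.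
  by apply: laurent_top_le (lead_at_top (xa 0)) _; lia.
rewrite big_ord_recl; apply: cf_countS; first exact: (xa 0).
apply: (IH (fun i => a i.+1)) => i.
by have := xa i.+1; rewrite iterSr.
Qed.

End CountAsymptotics.

Section Typical.
Context {R : realType} {F : finFieldType}.
Variable mu : {measure set (laurent F) -> \bar R}.
Hypothesis hmu : normalized_haar mu.
Let p : R := 1 - #|F|%:R^-1.

Definition count_typical (f : laurent F) := forall e : R, 0 < e ->
  exists n, forall N k, (n <= N)%N -> cf_count N k f ->
    `|k%:R - p * N%:R| < e * N%:R.

Lemma count_typical_ae : mu.-negligible
  [set f : laurent F | laurent_top f (-1) /\ ~ count_typical f].
Proof.
apply: (@negligibleS _ _ _ _ (\bigcup_i lim_sup_set (@count_deviates R F i.+1%:R^-1))).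
  move=> f [f1 ntyp]; apply: contrapT => nf; apply: ntyp => e e0.
  have [i ie] : exists i, i.+1%:R^-1 < e.
    exists (Num.bound e^-1); rewrite -[ltRHS]invrK ltf_pV2 ?posrE ?invr_gt0 //.
    apply: lt_trans (archi_boundP _) _; last by rewrite ltr_nat.
    by rewrite invr_ge0 ltW.
  apply: contrapT => H; apply: nf; exists i => // n _.
  apply: contrapT => nn; apply: H; exists n => N k nN fk.
  rewrite ltNge; apply/negP => dev; apply: nn; exists N => //.
  split=> //; exists k => //; apply: le_trans dev.
  by rewrite ler_wpM2r // ltW.
apply: negligible_bigcup => i; apply: (count_deviates_negligible hmu) => //.
by rewrite invf_le1 // ler1n.
Qed.

Lemma count_typical_nonterminating (f : laurent F) k :
  laurent_top f (-1) -> count_typical f ->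
  iter k (fun x => lfrac x^-1) f != 0.
Proof.
move=> f1 typ; apply/eqP => /(cf_count_terminating f1)[j [N0 H]].
have q1 := @card_field_gt1 R F.
have p0 : 0 < p by rewrite subr_gt0 invf_lt1 // (lt_trans _ q1).
(* With tolerance p/2 the count exceeds $Np/2$, which a constant j cannot do once $N>2j/p$. *)
have [|n Hn] := typ (p / 2); first by rewrite divr_gt0.
have [m jm] : exists m : nat, j%:R / (p / 2) < m%:R :> R.
  by exists (Num.bound (j%:R / (p / 2))); rewrite archi_boundP // !divr_ge0 // ltW.
pose N := (maxn m (maxn n N0)).
have := Hn N j _ (H N _); rewrite !leq_max !leqnn !orbT => /(_ isT isT).
have mN : m%:R <= N%:R :> R by rewrite ler_nat leq_maxl.
rewrite ltr_pdivrMr ?divr_gt0 // in jm.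
rewrite distrC => /(le_lt_trans (ler_norm _)).
have : m%:R * (p / 2) <= N%:R * (p / 2) by rewrite ler_wpM2r // ltW // divr_gt0.
lra.
Qed.

Lemma logb_absv (f : laurent F) (e : nat) : lead_at f (- e%:Z) ->
  logb #|F|%:R (absv R f) = - e%:R.
Proof.
move=> fe; have q1 := @card_field_gt1 R F.
have q0 : 0 < #|F|%:R :> R by rewrite (lt_trans _ q1).
rewrite /logb /absv (deg_lead fe) -invr_expz lnV ?posrE ?exprz_gt0 //.
rewrite -exprnP lnXn // mulNr -[ln _ *+ e]mulr_natl mulfK // gt_eqF //.
exact: ln_gt0.
Qed.

End Typical.

Section DenominatorGrowth.
Context {R : realType}.
Variables (p : R) (D : nat -> R).
Hypothesis p0 : 0 < p.
Hypothesis Dp : (fun k => k%:R / D k) @ \oo --> p.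

Let DV : (fun k => D k / k%:R) @ \oo --> p^-1.
Proof.
have -> : (fun k => D k / k%:R) = (fun k => (k%:R / D k)^-1).
  by apply/funext => k; rewrite invf_div.
by apply: cvgV => //; rewrite gt_eqF.
Qed.

(** From here on everything is divided by $k=m+1$, which is never zero. *)
Let DV1 : (fun m => D m.+1 / m.+1%:R) @ \oo --> p^-1.
Proof. by have := DV; rewrite -(cvg_shiftS (fun k => D k / k%:R)). Qed.

Let DV2 : (fun m => D m.+2 / m.+1%:R) @ \oo --> p^-1.
Proof.
have -> : (fun m => D m.+2 / m.+1%:R) =
    (fun m => D m.+2 / m.+2%:R * (1 + m.+1%:R^-1)).
  apply/funext => m; rewrite -[m.+2%:R]natr1.
  move: (m.+1%:R) (ltr0Sn R m) => x x0.
  by field; rewrite !gt_eqF // addr_gt0.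
rewrite -[p^-1]mulr1 -[X in _ * X]addr0; apply: cvgM.
  by have := DV1; rewrite -(cvg_shiftS (fun k => D k.+1 / k.+1%:R)).
by apply: cvgD; [exact: cvg_cst | exact: cvg_harmonic].
Qed.

Let DV0 : D 0 = 0 -> (fun m => D m / m.+1%:R) @ \oo --> p^-1.
Proof.
move=> D0; have -> : (fun m => D m / m.+1%:R) =
    (fun m => D m / m%:R * (1 - m.+1%:R^-1)).
  (* At m = 0 the right side is 0 because x/0 = 0, and the left side is 0 because D 0 = 0. *)
  apply/funext => -[|m]; first by rewrite D0 !mul0r.
  rewrite -[m.+2%:R]natr1; move: (m.+1%:R) (ltr0Sn R m) => x x0.
  by field; rewrite !gt_eqF // addr_gt0.
rewrite -[p^-1]mulr1 -[X in _ * X]subr0; apply: cvgM => //.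
by apply: cvgB; [exact: cvg_cst | exact: cvg_harmonic].
Qed.

(** Since $D_{k-1}$, $D_k$ and $D_{k+1}$ are all asymptotic to $k/p$, the ratio tends to
    $(2/p)/(1/p+1)$. *)
Lemma approx_ratio_lower : D 0 = 0 ->
  (fun k => (D k.-1 + D k) / (D k.+1 + k%:R)) @ \oo --> 2 / (1 + p).
Proof.
move=> D0; rewrite -(cvg_shiftS (fun k => (D k.-1 + D k) / (D k.+1 + k%:R))).
have -> : 2 / (1 + p) = (p^-1 + p^-1) / (p^-1 + 1).
  by field; rewrite !gt_eqF // addr_gt0.
have -> : (fun m => (D m.+1.-1 + D m.+1) / (D m.+2 + m.+1%:R)) =
    (fun m => (D m / m.+1%:R + D m.+1 / m.+1%:R) / (D m.+2 / m.+1%:R + 1)).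
  apply/funext => m /=; rewrite -mulrDl.
  rewrite (_ : _ + 1 = (D m.+2 + m.+1%:R) / m.+1%:R); last first.
    by rewrite mulrDl mulfV.
  by rewrite invf_div mulrA divfK.
apply: cvgM; first by apply: cvgD => //; exact: DV0.
apply: cvgV; first by rewrite gt_eqF // addr_gt0 // invr_gt0.
by apply: cvgD => //; exact: cvg_cst.
Qed.

Lemma approx_ratio_upper :
  (fun k => 2 * D k.+1 / (D k + k%:R)) @ \oo --> 2 / (1 + p).
Proof.
rewrite -(cvg_shiftS (fun k => 2 * D k.+1 / (D k + k%:R))).
have -> : 2 / (1 + p) = 2 * p^-1 / (p^-1 + 1).
  by field; rewrite !gt_eqF // addr_gt0.
have -> : (fun m => 2 * D m.+2 / (D m.+1 + m.+1%:R)) =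
    (fun m => 2 * (D m.+2 / m.+1%:R) / (D m.+1 / m.+1%:R + 1)).
  apply/funext => m /=; rewrite mulrA.
  rewrite (_ : _ + 1 = (D m.+1 + m.+1%:R) / m.+1%:R); last first.
    by rewrite mulrDl mulfV.
  by rewrite invf_div mulrA divfK.
apply: cvgM; first by apply: cvgM => //; exact: cvg_cst.
apply: cvgV; first by rewrite gt_eqF // addr_gt0 // invr_gt0.
by apply: cvgD => //; exact: cvg_cst.
Qed.

End DenominatorGrowth.

(** * The limit *)

Lemma lead_at_deg (F : fieldType) (f : laurent F) (n : int) :
  deg f = n%:E -> lead_at f n.
Proof.
have [->|/lead_exists[m fm]] := eqVneq f 0; first by rewrite deg0.
by rewrite (deg_lead fm) => -[<-].
Qed.

Lemma count_typical_limit (R : realType) (F : finFieldType) (h f : laurent F) :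
  lead_at h (-1) -> laurent_top f (-1) -> @count_typical R F f ->
  (fun l : nat => l%:R^-1 *
      logb #|F|%:R (absv R (f - farey_num h f l / farey_den h f l)))
    @ \oo --> - (2 / (1 + (1 - #|F|%:R^-1)) : R).
Proof.
move=> h1 f1 typ; set p : R := 1 - _.
have q1 := @card_field_gt1 R F.
have p0 : 0 < p by rewrite subr_gt0 invf_lt1 // (lt_trans _ q1).
pose gauss (x : laurent F) : laurent F := lfrac x^-1.
have /choice[a aP] k : exists n, lead_at (iter k gauss f) (- n.+1%:Z).
  have [e fe] := lead_exists (count_typical_nonterminating k f1 typ).
  have ft : laurent_top (iter k gauss f) (-1).
    by case: k {fe} => //= k; exact: lfrac_top.
  have e1 : e <= -1.
    by rewrite leNgt; apply/negP => /ft E; case: fe; rewrite E eqxx.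
  exists `|e|.-1; have -> // : - (`|e|.-1.+1)%:Z = e by lia.
pose d k := (\sum_(i < k) (a i).+1)%N.
have dS k : d k.+1 = (d k + (a k).+1)%N by rewrite /d big_ord_recr.
have dk k : (k <= d k)%N by elim: k => // k; rewrite dS; lia.
have dmono : {homo d : m n / (m <= n)%N}.
  by apply: homo_leq => // [m n k|k]; [exact: leq_trans | rewrite dS leq_addr].
pose D k : R := (d k)%:R.
have Dp : (fun k => k%:R / D k) @ \oo --> p.
  apply/cvgrPdist_lt => e e0; have [n nP] := typ e e0.
  exists (maxn n 1) => // k /=; rewrite geq_max => /andP[nk k0].
  have D0 : 0 < D k by rewrite ltr0n (leq_trans k0).
  have -> : p - k%:R / D k = (p * D k - k%:R) / D k.
    by rewrite mulrBl mulfK // gt_eqF.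
  rewrite normrM normfV (gtr0_norm D0) ltr_pdivrMr // distrC.
  by apply: nP (cf_count_convergent k aP); apply: leq_trans nk (dk k).
have := farey_approx_lead h1 (fun k => ltn0Sn (a k)) aP; rewrite -/d => approx.
have /choice[ke keP] l : exists ke : nat * nat, (0 < l)%N ->
    [/\ (d ke.1 + ke.1 <= l <= d ke.1.+1 + ke.1)%N,
      (d ke.1.-1 + d ke.1 <= ke.2 <= 2 * d ke.1.+1)%N &
      lead_at (f - farey_num h f l / farey_den h f l) (- ke.2%:Z)].
  have [->|l0] := posnP l; first by exists (0, 0)%N.
  by have [k [e H]] := approx l l0; exists (k, e).
(* k tends to infinity with l, for k < n forces $l\le d_n+n$. *)
have kcvg : (fun l => (ke l).1) @ \oo --> \oo.
  move=> A [n _ nA]; exists (d n.+1 + n).+1 => // l /= nl; apply: nA => /=.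
  have [/andP[_ ll] _ _] := keP l (leq_ltn_trans (leq0n _) nl).
  rewrite leqNgt; apply/negP => kn.
  have := leq_trans nl (leq_trans ll (leq_add (dmono _ _ (kn : ((ke l).1.+1 <= n)%N)) (ltnW kn))).
  by rewrite dS; lia.
have kpos : \forall l \near \oo, (0 < (ke l).1)%N.
  by apply: (kcvg [set k | (0 < k)%N]); exists 1%N.
have D0 : D 0%N = 0 by rewrite /D /d big_ord0.
have lower := cvg_comp _ _ kcvg (approx_ratio_lower p0 Dp D0).
have upper := cvg_comp _ _ kcvg (approx_ratio_upper p0 Dp).
apply: (squeeze_cvgr _ (cvgN upper) (cvgN lower)).
near=> l.
have l0 : (0 < l)%N by near: l; exists 1%N.
(* This keeps the denominator $d_k+k$ of the upper ratio positive. *)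
have k0 : (0 < (ke l).1)%N by near: l; exact: kpos.
have [/andP[dl ld] /andP[de ed] lead] := keP l l0.
rewrite (@logb_absv R _ _ _ lead) mulrN !lerN2 [_^-1 * _]mulrC /=.
have natD (m n : nat) : m%:R + n%:R = (m + n)%:R :> R by rewrite natrD.
rewrite /D !natD -natrM; apply/andP; split.
  apply: ler_pM; rewrite ?invr_ge0 ?ler_nat //.
  by rewrite lef_pV2 ?posrE ?ltr0n ?ler_nat //; lia.
apply: ler_pM; rewrite ?invr_ge0 ?ler_nat //.
by rewrite lef_pV2 ?posrE ?ltr0n ?ler_nat //; lia.
Unshelve. all: by end_near.
Qed.

Theorem theorem3 (R : realType) (F : finFieldType)
  (mu : {measure set (laurent F) -> \bar R}) (hmu : normalized_haar mu)
  (h : laurent F) (hL : open_unit_ball R F h) (hdeg : deg h = (-1)%:E) :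
  let q : R := #|F|%:R in
  {ae mu, forall f : laurent F, open_unit_ball R F f ->
     ~ laurent_rational f /\
     (fun l : nat => l%:R^-1 *
        logb q (absv R (f - farey_num h f l / farey_den h f l)))
       @ \oo --> - (2 * q / (2 * q - 1))}.
Proof.
move=> q; have h1 := lead_at_deg hdeg.
have q1 : 1 < q := @card_field_gt1 R F.
have -> : 2 * q / (2 * q - 1) = 2 / (1 + (1 - q^-1)).
  by field; rewrite !gt_eqF //; lra.
apply: negligibleS (negligibleU (laurent_rational_negligible hmu)
  (count_typical_ae hmu)) => f /= nf.
apply: contrapT => /not_orP[frat ftyp]; apply: nf.
rewrite open_unit_ballE lball0P => f1; split=> //.
apply: count_typical_limit => //.
by apply: contrapT => ntyp; apply: ftyp.
Qed.
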